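(* Let $A\in\mathbb{R}^{n\times n}$, $B\in\mathbb{R}^{n\times m}$ with $(A,B)$ controllable, $Q\in\mathbb{R}^{n\times n}$ symmetric positive semidefinite with $(A,Q^{1/2})$ observable, $R\in\mathbb{R}^{m\times m}$ symmetric positive definite, and let $P^*$ be the unique symmetric positive definite solution of $A^TP+PA-PBR^{-1}B^TP+Q=0$. For symmetric $P$ let $\mathcal{A}(P)=A-BR^{-1}B^TP$. Consider the robust policy iteration: given a symmetric $\tilde P_0\in\mathbb{R}^{n\times n}$, set $\hat K_1=R^{-1}B^T\tilde P_0$ and $\Delta G_0=0$; given a sequence $(\Delta G_i)_{i\ge1}$ of symmetric $(n+m)\times(n+m)$ matrices, for $i=1,2,\dots$, as long as $\hat K_i$ is stabilizing (i.e. $A-B\hat K_i$ is Hurwitz), let $\tilde P_i$ be the unique symmetric solution of $$(A-B\hat K_i)^T\tilde P_i+\tilde P_i(A-B\hat K_i)+Q+\hat K_i^TR\hat K_i=0,$$ let $$\tilde G_i=\begin{bmatrix} Q+A^T\tilde P_i+\tilde P_iA & \tilde P_iB\\ B^T\tilde P_i & R\end{bmatrix},\qquad \hat G_i=\tilde G_i+\Delta G_i,$$ and, when the lower-right $m\times m$ block $\hat G_{i,22}$ of $\hat G_i$ is invertible, set $\hat K_{i+1}=\hat G_{i,22}^{-1}\hat G_{i,21}$, where $\hat G_{i,21}$ is the lower-left $m\times n$ block of $\hat G_i$. Write $\|\Delta G\|_\infty=\sup_{i\ge 0}\|\Delta G_i\|_F$. Then for every $\sigma\in(0,1)$ there exists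 $\delta_0>0$ such that (a) for every symmetric $P$ with $\|P-P^*\|_F<\delta_0$, $\mathcal{A}(P)$ is Hurwitz and the symmetric solution $P^+$ of $\mathcal{A}(P)^TP^++P^+\mathcal{A}(P)=-Q-PBR^{-1}B^TP$ satisfies $\|P^+-P^*\|_F\le\sigma\|P-P^*\|_F$, and (b) there exist constants $\delta_1>0$ and $c_3>0$ (depending on $\delta_0$) such that, whenever $\|\tilde P_0-P^*\|_F<\delta_0$ and $\|\Delta G\|_\infty<\delta_1$: (i) $\hat G_{i,22}$ is invertible and $\hat K_i$ is stabilizing for all integers $i\ge1$ (so the iteration is well defined for all $i$); (ii) for all integers $i\ge0$, $$\|\tilde P_i-P^*\|_F\le \sigma^i\|\tilde P_0-P^*\|_F+\frac{c_3}{1-\sigma}\|\Delta G\|_\infty;$$ (iii) if $\lim_{i\to\infty}\|\Delta G_i\|_F=0$, then $\lim_{i\to\infty}\|\tilde P_i-P^*\|_F=0$.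
   Context: $\|\cdot\|_F$ denotes the Frobenius norm; a square matrix is Hurwitz if all its eigenvalues have negative real part; a gain $K\in\mathbb{R}^{m\times n}$ is stabilizing if $A-BK$ is Hurwitz. $\Delta G_i$ models errors in the policy evaluation step of Kleinman's policy iteration for the LQR problem of minimizing $\int_0^\infty x^TQx+u^TRu\,dt$ subject to $\dot x=Ax+Bu$. The conclusion (ii) is a local input-to-state stability property of the iteration with $\Delta G$ as input. *)

(* Defs.v *)
From HB Require Import structures.
From mathcomp Require Import all_boot all_order all_algebra.
From mathcomp Require Import complex.
From mathcomp Require Import all_classical all_reals all_analysis.

Set Implicit Arguments.
Unset Strict Implicit.
Unset Printing Implicit Defensive.

Import Order.TTheory GRing.Theory Num.Theory.
Local Open Scope ring_scope.

Section Defs.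
Variable R : realType.

Definition frob (p q : nat) (M : 'M[R]_(p, q)) : R :=
  Num.sqrt (\sum_(i < p) \sum_(j < q) M i j ^+ 2).

Definition sym_mx (p : nat) (M : 'M[R]_p) : Prop := M^T = M.

Definition psd_mx (p : nat) (M : 'M[R]_p) : Prop :=
  sym_mx M /\ forall x : 'cV[R]_p, 0 <= (x^T *m M *m x) 0 0.

Definition pd_mx (p : nat) (M : 'M[R]_p) : Prop :=
  sym_mx M /\ forall x : 'cV[R]_p, x != 0 -> 0 < (x^T *m M *m x) 0 0.

Definition hurwitz (p : nat) (M : 'M[R]_p) : Prop :=
  forall z : R[i], eigenvalue (map_mx (fun x : R => (x%:C)%C) M) z ->
    complex.Re z < 0.

Definition controllable (p q : nat) (A : 'M[R]_p) (B : 'M[R]_(p, q)) : Prop :=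
  \rank (\mxrow_(i < p) (A ^+ i *m B)) = p.

Definition observable (p q : nat) (A : 'M[R]_p) (C : 'M[R]_(q, p)) : Prop :=
  \rank (\mxcol_(i < p) (C *m A ^+ i)) = p.

End Defs.

Section LQR.
Variables (R : realType) (n m : nat).
Variables (A : 'M[R]_n) (B : 'M[R]_(n, m)) (Q : 'M[R]_n) (Rm : 'M[R]_m).

Definition riccati (P : 'M[R]_n) : Prop :=
  A^T *m P + P *m A - P *m B *m invmx Rm *m B^T *m P + Q = 0.

Definition calA (P : 'M[R]_n) : 'M[R]_n := A - B *m invmx Rm *m B^T *m P.

Definition pe_eq (K : 'M[R]_(m, n)) (P : 'M[R]_n) : Prop :=
  (A - B *m K)^T *m P + P *m (A - B *m K) + Q + K^T *m Rm *m K = 0.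

Definition Gtilde (P : 'M[R]_n) : 'M[R]_(n + m) :=
  block_mx (Q + A^T *m P + P *m A) (P *m B) (B^T *m P) Rm.

Definition Ghat (DG : nat -> 'M[R]_(n + m)) (Pt : nat -> 'M[R]_n) (i : nat)
  : 'M[R]_(n + m) := Gtilde (Pt i) + DG i.

(* The sequences Kh (gains \hat K_i, i >= 1) and Pt (\tilde P_i, i >= 0)
   are generated by the robust policy iteration from \tilde P_0 = P0 with
   disturbances DG, as long as the iteration is well defined. *)
Definition robust_PI (P0 : 'M[R]_n) (DG : nat -> 'M[R]_(n + m))
  (Kh : nat -> 'M[R]_(m, n)) (Pt : nat -> 'M[R]_n) : Prop :=
  [/\ Pt 0 = P0,
      Kh 1%N = invmx Rm *m B^T *m P0,
      (forall i, (0 < i)%N -> hurwitz (A - B *m Kh i) ->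
         sym_mx (Pt i) /\ pe_eq (Kh i) (Pt i)) &
      (forall i, (0 < i)%N -> hurwitz (A - B *m Kh i) ->
         drsubmx (Ghat DG Pt i) \in unitmx ->
         Kh i.+1 = invmx (drsubmx (Ghat DG Pt i)) *m dlsubmx (Ghat DG Pt i))].

End LQR.

(* Main.v *)
(* Write [Ks = R^-1 B^T Ps]. If [P] evaluates the gain [K], then [X = P - Ps]
   solves [(A - B K)^T X + X (A - B K) = - (K - Ks)^T R (K - Ks)]. Near [Ks] the
   closed loop stays Hurwitz and its Lyapunov operator is bounded below, so
   [|P - Ps| <= c |K - Ks|^2]. Policy improvement from [P] with error [D] gives
   [|K - Ks| <= a |P - Ps| + b |D|], hence one iteration satisfies
   [|P+ - Ps| <= 2 c a^2 |P - Ps|^2 + 2 c b^2 |D|^2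
             <= sigma |P - Ps| + c3 |D|]
   close to [Ps], and the claims follow from this scalar recursion. *)

Require Import Defs.
From HB Require Import structures.
From mathcomp Require Import all_boot all_order all_algebra.
From mathcomp Require Import complex.
From mathcomp Require Import all_classical all_reals all_analysis.
From mathcomp Require Import ring lra.

Import Order.TTheory GRing.Theory Num.Theory numFieldNormedType.Exports.
Local Open Scope ring_scope.
Local Open Scope classical_set_scope.

Set Implicit Arguments.
Unset Strict Implicit.
Unset Printing Implicit Defensive.

(** * Cauchy-Schwarz inequality for finite sums *)

Lemma discriminant_le (R : realFieldType) (a b c : R) :
  0 <= a -> 0 <= c -> (forall t : R, 0 <= a * t ^+ 2 + 2 * b * t + c) ->
  b ^+ 2 <= a * c.
Proof.
move=> a0 c0 H; have [a_eq0|a_neq0] := eqVneq a 0.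
  suff -> : b = 0 by rewrite a_eq0 mul0r expr0n.
  apply/eqP/negPn/negP => b0.
  (* With [a = 0] the polynomial is affine, and at this point it takes the value [-1]. *)
  have := H (- (c + 1) / (2 * b)); rewrite a_eq0 mul0r add0r.
  have -> : 2 * b * (- (c + 1) / (2 * b)) = - (c + 1) by field.
  by move=> ?; lra.
have a_gt0 : 0 < a by rewrite lt_def a_neq0.
(* This point is the minimiser of the quadratic. *)
have := H (- b / a).
have -> : a * (- b / a) ^+ 2 + 2 * b * (- b / a) + c = (a * c - b ^+ 2) / a.
  by field.
by rewrite pmulr_lge0 ?invr_gt0// subr_ge0.
Qed.

Lemma sum_cauchy_schwarz (R : realFieldType) (I : finType) (f g : I -> R) :
  (\sum_i f i * g i) ^+ 2 <= (\sum_i f i ^+ 2) * (\sum_i g i ^+ 2).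
Proof.
apply: discriminant_le; try by apply: sumr_ge0 => i _; apply: sqr_ge0.
move=> t; suff -> : (\sum_i f i ^+ 2) * t ^+ 2 + 2 * (\sum_i f i * g i) * t +
    \sum_i g i ^+ 2 = \sum_i (f i * t + g i) ^+ 2.
  by apply: sumr_ge0 => i _; apply: sqr_ge0.
rewrite mulr_sumr !mulr_suml -!big_split /=.
by apply: eq_bigr => i _; ring.
Qed.

(** * The Frobenius norm *)

Section Frobenius.
Variable R : realType.

Lemma frob_ge0 p q (M : 'M[R]_(p, q)) : 0 <= frob M.
Proof. exact: sqrtr_ge0. Qed.

Lemma sqr_frob p q (M : 'M[R]_(p, q)) :
  frob M ^+ 2 = \sum_i \sum_j M i j ^+ 2.
Proof.
by rewrite sqr_sqrtr//; do 2 apply: sumr_ge0 => ? _; apply: sqr_ge0.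
Qed.

Lemma frob_le_sqr p q (M : 'M[R]_(p, q)) (c : R) :
  0 <= c -> (frob M <= c) = (\sum_i \sum_j M i j ^+ 2 <= c ^+ 2).
Proof. by move=> c0; rewrite -sqr_frob ler_pXn2r// nnegrE ?frob_ge0. Qed.

Lemma frob0 p q : frob (0 : 'M[R]_(p, q)) = 0.
Proof.
rewrite /frob big1 ?sqrtr0// => i _; rewrite big1// => j _.
by rewrite mxE expr0n.
Qed.

Lemma frob_eq0 p q (M : 'M[R]_(p, q)) : (frob M == 0) = (M == 0).
Proof.
apply/eqP/eqP => [M0|->]; last exact: frob0.
have H : \sum_i \sum_j M i j ^+ 2 = 0 by rewrite -sqr_frob M0 expr0n.
apply/matrixP => i j; rewrite mxE; apply/eqP; rewrite -sqrf_eq0; apply/eqP.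
have Mi : \sum_j M i j ^+ 2 = 0.
  apply: psumr_eq0P H i isT => k _.
  by apply: sumr_ge0 => ? _; apply: sqr_ge0.
by apply: psumr_eq0P Mi j isT => k _; apply: sqr_ge0.
Qed.

Lemma frob_gt0 p q (M : 'M[R]_(p, q)) : M != 0 -> 0 < frob M.
Proof. by move=> M0; rewrite lt_def frob_eq0 M0 frob_ge0. Qed.

Lemma frobZ p q (a : R) (M : 'M[R]_(p, q)) : frob (a *: M) = `|a| * frob M.
Proof.
rewrite /frob -sqrtr_sqr -sqrtrM ?sqr_ge0//; congr Num.sqrt.
rewrite mulr_sumr; apply: eq_bigr => i _; rewrite mulr_sumr.
by apply: eq_bigr => j _; rewrite mxE exprMn.
Qed.

Lemma frobN p q (M : 'M[R]_(p, q)) : frob (- M) = frob M.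
Proof. by rewrite -scaleN1r frobZ normrN1 mul1r. Qed.

Lemma frob_tr p q (M : 'M[R]_(p, q)) : frob M^T = frob M.
Proof.
rewrite /frob exchange_big; congr Num.sqrt.
by do 2 (apply: eq_bigr => ? _); rewrite mxE.
Qed.

Lemma frobD p q (M N : 'M[R]_(p, q)) : frob (M + N) <= frob M + frob N.
Proof.
rewrite frob_le_sqr ?addr_ge0 ?frob_ge0// sqrrD !sqr_frob.
have -> : \sum_i \sum_j (M + N) i j ^+ 2 = \sum_i \sum_j M i j ^+ 2 +
    (\sum_i \sum_j M i j * N i j) *+ 2 + \sum_i \sum_j N i j ^+ 2.
  rewrite -sumrMnl -!big_split; apply: eq_bigr => i _ /=.
  rewrite -sumrMnl -!big_split; apply: eq_bigr => j _ /=.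
  by rewrite mxE sqrrD.
rewrite lerD2r lerD2l lerMn2r /=.
apply: le_trans (ler_norm _) _.
rewrite -(ler_pXn2r (n := 2))// ?nnegrE ?mulr_ge0 ?frob_ge0//.
rewrite real_normK ?num_real// exprMn !sqr_frob.
by rewrite !pair_big; apply: sum_cauchy_schwarz.
Qed.

Lemma frobB p q (M N : 'M[R]_(p, q)) : frob (M - N) <= frob M + frob N.
Proof. by rewrite -[frob N]frobN frobD. Qed.

Lemma frobM p q r (M : 'M[R]_(p, q)) (N : 'M[R]_(q, r)) :
  frob (M *m N) <= frob M * frob N.
Proof.
rewrite frob_le_sqr ?mulr_ge0 ?frob_ge0// exprMn !sqr_frob mulr_suml.
apply: ler_sum => i _; rewrite [X in _ * X]exchange_big mulr_sumr.
by apply: ler_sum => j _; rewrite mxE sum_cauchy_schwarz.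
Qed.

(** Used to bound a linear operator on matrices through the matrix of its vectorised form. *)
Lemma frob_mxvec p q (M : 'M[R]_(p, q)) : frob (mxvec M) = frob M.
Proof.
rewrite /frob big_ord1 pair_big; congr Num.sqrt.
rewrite (reindex _ (curry_mxvec_bij p q)) /=.
by apply: eq_bigr => -[i j] _; rewrite mxvecE.
Qed.

Lemma frob_drsubmx p q p' q' (M : 'M[R]_(p + q, p' + q')) :
  frob (drsubmx M) <= frob M.
Proof.
rewrite frob_le_sqr ?frob_ge0// sqr_frob [leRHS]big_split_ord /=.
rewrite -[leLHS]add0r lerD//.
  by do 2 apply: sumr_ge0 => ? _; apply: sqr_ge0.
apply: ler_sum => i _; rewrite big_split_ord /= -[leLHS]add0r lerD//.
  by apply: sumr_ge0 => ? _; apply: sqr_ge0.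
by apply: ler_sum => j _; rewrite !mxE.
Qed.

Lemma frob_dlsubmx p q p' q' (M : 'M[R]_(p + q, p' + q')) :
  frob (dlsubmx M) <= frob M.
Proof.
rewrite frob_le_sqr ?frob_ge0// sqr_frob [leRHS]big_split_ord /=.
rewrite -[leLHS]add0r lerD//.
  by do 2 apply: sumr_ge0 => ? _; apply: sqr_ge0.
apply: ler_sum => i _; rewrite big_split_ord /= -[leLHS]addr0 lerD//.
  by apply: ler_sum => j _; rewrite !mxE.
by apply: sumr_ge0 => ? _; apply: sqr_ge0.
Qed.

Lemma ler_norm_frob (M : 'M[R]_1) : `|M 0 0| <= frob M.
Proof. by rewrite /frob !big_ord1 sqrtr_sqr. Qed.

Lemma sqr_frob_cV p (x : 'cV[R]_p) : (x^T *m x) 0 0 = frob x ^+ 2.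
Proof.
rewrite sqr_frob mxE; apply: eq_bigr => i _.
by rewrite big_ord1 mxE expr2.
Qed.

Lemma norm_bilinear_le p q (M : 'M[R]_(p, q)) (x : 'cV[R]_p) (y : 'cV[R]_q) :
  `|(x^T *m M *m y) 0 0| <= frob M * (frob x * frob y).
Proof.
apply: le_trans (ler_norm_frob _) _; apply: le_trans (frobM _ _) _.
rewrite mulrA ler_wpM2r ?frob_ge0// mulrC -[frob x]frob_tr.
exact: frobM.
Qed.

End Frobenius.

(** * Eigenvalues and the homogeneous Sylvester equation *)

Lemma unitmx_eigenvalue (F : fieldType) p (A : 'M[F]_p) (z : F) :
  (A - z%:M \in unitmx) = ~~ eigenvalue A z.
Proof. by rewrite negbK -row_free_unit -kermx_eq0. Qed.

Lemma eigenvalue_tr (F : fieldType) p (A : 'M[F]_p) (z : F) :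
  eigenvalue A^T z = eigenvalue A z.
Proof.
apply: negb_inj; rewrite -!unitmx_eigenvalue -unitmx_tr.
by rewrite linearB /= trmxK tr_scalar_mx.
Qed.

Lemma eigenvalueN (F : fieldType) p (A : 'M[F]_p) (z : F) :
  eigenvalue (- A) z = eigenvalue A (- z).
Proof.
apply/eigenvalueP/eigenvalueP => -[v vA v0]; exists v => //.
  by apply: oppr_inj; rewrite -mulmxN vA scaleNr opprK.
by rewrite mulmxN vA scaleNr opprK.
Qed.

(* If [p] is the characteristic polynomial of [A], then
   [0 = X p(A) = p(B) X], and [p(B)] is invertible. *)
Lemma sylvester_eq0 (F : closedFieldType) p q
  (A : 'M[F]_p) (B : 'M[F]_q) (X : 'M[F]_(q, p)) :
  (forall z, eigenvalue A z -> ~~ eigenvalue B z) ->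
  X *m A = B *m X -> X = 0.
Proof.
case: p A X => [|p] A X AB XA; first by rewrite [X]thinmx0.
have [s sE] := closed_field_poly_normal (char_poly A).
have s_root z : z \in s -> eigenvalue A z.
  move=> zs; rewrite eigenvalue_root_char sE rootE hornerZ horner_prod.
  rewrite (big_rem z)//= hornerD hornerN hornerX hornerC subrr.
  by rewrite mul0r mulr0.
have := Cayley_Hamilton A.
rewrite sE (monicP (char_poly_monic A)) scale1r => /(congr1 (mulmx X)).
rewrite mulmx0; move: s_root; elim: s {sE} X XA => [|z s IH] X XA s_root.
  by rewrite big_nil rmorph1 mulmx1.
rewrite big_cons rmorphM rmorphB /= horner_mx_X horner_mx_C.
rewrite mulmxA mulmxBr XA mul_mx_scalar -mul_scalar_mx -mulmxBl.
have Bz : B - z%:M \in unitmx.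
  by rewrite unitmx_eigenvalue AB// s_root// mem_head.
move=> /IH X0; rewrite -[X](mulKmx Bz) X0 ?mulmx0//.
  rewrite -!mulmxA XA !mulmxA; congr (_ *m _).
  by rewrite mulmxBl mulmxBr scalar_mxC.
by move=> y ys; rewrite s_root// in_cons ys orbT.
Qed.

(** * Hurwitz matrices and the Lyapunov operator *)

Section Hurwitz.
Variable R : realType.

(** The equation reads [X A = - A^T X]. The spectrum of [A] lies in the open left half-plane and
    that of [- A^T] in the open right one, so they are disjoint and [sylvester_eq0] applies over the
    complex numbers. *)
Lemma hurwitz_lyapunov_eq0 p (A X : 'M[R]_p) :
  hurwitz A -> A^T *m X + X *m A = 0 -> X = 0.
Proof.
move=> hA /eqP; rewrite addrC addr_eq0 -mulNmx => /eqP XA.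
have f_inj : injective (fun M : 'M[R]_p => map_mx (real_complex R) M).
  by apply: map_mx_inj.
apply: f_inj; rewrite map_mx0.
apply: (@sylvester_eq0 _ _ _ (map_mx (real_complex R) A)
  (- (map_mx (real_complex R) A)^T)); last first.
  by rewrite -map_mxM XA map_mxM map_mxN map_trmx.
move=> z Az; rewrite eigenvalueN eigenvalue_tr; apply/negP => ANz.
have := hA _ Az; have := hA _ ANz; rewrite raddfN /= oppr_lt0.
by move=> z0 /(lt_trans z0); rewrite ltxx.
Qed.

(** [x] and [y] are the real and imaginary parts of a complex eigenvector. Passing to the transpose
    turns the row eigenvectors of [eigenvalue] into columns. *)
Lemma eigenvalue_real_imaginary p (A : 'M[R]_p) (z : R[i]) :
  eigenvalue (map_mx (fun x : R => (x%:C)%C) A) z ->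
  exists x y : 'cV[R]_p, [/\ (x != 0) || (y != 0),
    A *m x = complex.Re z *: x - complex.Im z *: y &
    A *m y = complex.Im z *: x + complex.Re z *: y].
Proof.
rewrite -eigenvalue_tr => /eigenvalueP[v vA v0].
exists (\col_i complex.Re (v 0 i)), (\col_i complex.Im (v 0 i)).
have vAE i : \sum_j v 0 j * ((A i j)%:C)%C = z * v 0 i.
  move/matrixP : vA => /(_ 0 i); rewrite !mxE => <-.
  by apply: eq_bigr => j _; rewrite !mxE.
split.
- rewrite -negb_and; apply: contra v0 => /andP[/eqP/matrixP x0 /eqP/matrixP y0].
  apply/eqP/matrixP => i j; rewrite ord1 !mxE.
  have := x0 j 0; have := y0 j 0; rewrite !mxE.
  by case: (v 0 j) => a b /= -> ->.
- apply/colP => i; rewrite !mxE.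
  have := congr1 (@complex.Re R) (vAE i); rewrite raddf_sum.
  under eq_bigr => j _ do rewrite -(mulrC (A i j)%:C%C).
  have -> : complex.Re (z * v 0 i) = complex.Re z * complex.Re (v 0 i) -
     complex.Im z * complex.Im (v 0 i) by case: z {vA vAE}; case: (v 0 i).
  move=> <-; apply: eq_bigr => j _; rewrite !mxE.
  by case: (v 0 j) => a b /=; rewrite mul0r subr0.
- apply/colP => i; rewrite !mxE.
  have := congr1 (@complex.Im R) (vAE i); rewrite raddf_sum.
  under eq_bigr => j _ do rewrite -(mulrC (A i j)%:C%C).
  have -> : complex.Im (z * v 0 i) = complex.Im z * complex.Re (v 0 i) +
     complex.Re z * complex.Im (v 0 i).
    by case: z {vA vAE}; case: (v 0 i) => a b c d /=; rewrite addrC (mulrC d).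
  move=> <-; apply: eq_bigr => j _; rewrite !mxE.
  by case: (v 0 j) => a b /=; rewrite mul0r addr0.
Qed.

(** Kept as a function of [X] so that it can be declared linear and inverted through [lin_mx]. *)
Definition lyapunov p (A X : 'M[R]_p) : 'M[R]_p := A^T *m X + X *m A.

Lemma lyapunov_is_linear p (A : 'M[R]_p) : linear (lyapunov A).
Proof.
move=> a X Y; rewrite /lyapunov mulmxDr mulmxDl -scalemxAl -scalemxAr.
by rewrite scalerDr addrACA.
Qed.

HB.instance Definition _ p (A : 'M[R]_p) :=
  GRing.isLinear.Build R 'M[R]_p 'M[R]_p _ (lyapunov A) (lyapunov_is_linear A).

(** An injective endomorphism of a finite-dimensional space is bijective, and the norm of the
    inverse of its matrix gives the bound. *)
Lemma lyapunov_solvable p (A : 'M[R]_p) : hurwitz A ->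
  (forall Y, exists X, lyapunov A X = Y) /\
  exists2 c : R, 0 < c & forall X, frob X <= c * frob (lyapunov A X).
Proof.
move=> hA; pose L : 'M[R]_p -> 'M[R]_p := lyapunov A.
have Lu : lin_mx L \in unitmx.
  rewrite -row_free_unit; apply: inj_row_free => v.
  rewrite mul_rV_lin /= => /eqP; rewrite mxvec_eq0 => /eqP Lv0.
  by rewrite -[v]vec_mxK (hurwitz_lyapunov_eq0 hA Lv0) linear0.
split=> [Y|].
  exists (vec_mx (mxvec Y *m invmx (lin_mx L))).
  by apply: (can_inj mxvecK); rewrite -mul_rV_lin mulmxKV.
(* The [+ 1] keeps the constant positive even when the norm vanishes, as for [p = 0]; later
   constants use the same device. *)
exists (frob (invmx (lin_mx L)) + 1); first by rewrite ltr_wpDl ?frob_ge0.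
move=> X; rewrite -(frob_mxvec X) -[mxvec X](mulmxK Lu) mul_vec_lin.
apply: le_trans (frobM _ _) _; rewrite frob_mxvec mulrC.
by rewrite ler_wpM2r ?frob_ge0// lerDl.
Qed.

Lemma frob_lyapunov p (A X : 'M[R]_p) :
  frob (lyapunov A X) <= 2 * frob A * frob X.
Proof.
apply: le_trans (frobD _ _) _; rewrite mulrAC -mulrA mulr_natl mulr2n.
rewrite lerD//; last exact: frobM.
by apply: le_trans (frobM _ _) _; rewrite frob_tr mulrC.
Qed.

Lemma lyapunovDl p (A E X : 'M[R]_p) :
  lyapunov (A + E) X = lyapunov A X + lyapunov E X.
Proof. by rewrite /lyapunov linearD/= mulmxDl mulmxDr addrACA. Qed.

Lemma sym_bilinearC p (M : 'M[R]_p) (x y : 'cV[R]_p) : sym_mx M ->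
  (x^T *m M *m y) 0 0 = (y^T *m M *m x) 0 0.
Proof.
move=> sM; have -> : y^T *m M *m x = (x^T *m M *m y)^T.
  by rewrite !trmx_mul trmxK sM mulmxA.
by rewrite [RHS]mxE.
Qed.

(** Real form of [v^* (A^T P + P A) v = 2 Re(z) v^* P v] for [v = x + i y] and [z = a + i b]; the
    cross terms in [b] cancel because [P] is symmetric. *)
Lemma lyapunov_eigenvector p (A P : 'M[R]_p) (a b : R) (x y : 'cV[R]_p) :
  sym_mx P -> A *m x = a *: x - b *: y -> A *m y = b *: x + a *: y ->
  (x^T *m lyapunov A P *m x) 0 0 + (y^T *m lyapunov A P *m y) 0 0 =
  2 * a * ((x^T *m P *m x) 0 0 + (y^T *m P *m y) 0 0).
Proof.
move=> sP Ax Ay.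
have E (w : 'cV_p) : (w^T *m lyapunov A P *m w) 0 0 = 2 * (w^T *m P *m (A *m w)) 0 0.
  rewrite /lyapunov mulmxDr mulmxDl mxE mulr_natl mulr2n.
  congr (_ + _); last by rewrite !mulmxA.
  by rewrite [RHS]sym_bilinearC// trmx_mul !mulmxA.
rewrite !E Ax Ay mulmxBr mulmxDr -!scalemxAr.
do 8! rewrite ?[(_ + _ : 'M[R]_(_, _)) _ _]mxE
  ?[(- _ : 'M[R]_(_, _)) _ _]mxE ?[(_ *: _ : 'M[R]_(_, _)) _ _]mxE.
rewrite (sym_bilinearC y x sP); ring.
Qed.

(** An eigenvalue with nonnegative real part would make the right side of [lyapunov_eigenvector]
    nonnegative, while the left side is negative. *)
Lemma lyapunov_hurwitz p (A P : 'M[R]_p) : psd_mx P ->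
  (forall x : 'cV_p, x != 0 -> (x^T *m lyapunov A P *m x) 0 0 < 0) ->
  hurwitz A.
Proof.
move=> [sP P0] neg z /eigenvalue_real_imaginary[x [y [xy0 Ax Ay]]].
have neg0 (w : 'cV_p) : (w^T *m lyapunov A P *m w) 0 0 <= 0.
  by have [->|/neg/ltW] := eqVneq w 0; rewrite ?mulmx0 ?mxE.
have := lyapunov_eigenvector sP Ax Ay.
have := P0 x; have := P0 y; rewrite ltNge => ? ? E; apply/negP => a0.
have : (x^T *m lyapunov A P *m x) 0 0 + (y^T *m lyapunov A P *m y) 0 0 < 0.
  by have := neg0 x; have := neg0 y; case/orP: xy0 => /neg; lra.
by rewrite E ltNge mulr_ge0// ?addr_ge0// mulr_ge0.
Qed.

End Hurwitz.

(** * Definite forms, robustness of stability, and observability *)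

Section Definite.
Variable R : realType.

Lemma psd_cauchy_schwarz p (M : 'M[R]_p) (x y : 'cV[R]_p) : psd_mx M ->
  (x^T *m M *m y) 0 0 ^+ 2 <= (x^T *m M *m x) 0 0 * (y^T *m M *m y) 0 0.
Proof.
move=> [sM M0]; apply: discriminant_le => // t.
suff -> : (x^T *m M *m x) 0 0 * t ^+ 2 + 2 * (x^T *m M *m y) 0 0 * t +
    (y^T *m M *m y) 0 0 =
    ((t *: x + y)^T *m M *m (t *: x + y)) 0 0 by [].
rewrite [(_ + _)^T]linearD /= [(_ *: _)^T]linearZ /= mulmxDr !mulmxDl.
rewrite -!scalemxAl -!scalemxAr.
do 8! rewrite ?[(_ + _ : 'M[R]_(_, _)) _ _]mxE ?[(_ *: _ : 'M[R]_(_, _)) _ _]mxE.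
rewrite (sym_bilinearC y x sM); ring.
Qed.

Lemma pd_psd p (M : 'M[R]_p) : pd_mx M -> psd_mx M.
Proof.
move=> [sM M0]; split=> // x; have [->|/M0/ltW//] := eqVneq x 0.
by rewrite mulmx0 mxE.
Qed.

Lemma pd_unitmx p (M : 'M[R]_p) : pd_mx M -> M \in unitmx.
Proof.
move=> [sM M0]; rewrite -unitmx_tr -row_free_unit; apply: inj_row_free => v.
move=> /(congr1 trmx); rewrite trmx_mul trmxK trmx0 => Mv.
apply: trmx_inj; rewrite trmx0; apply/eqP/negPn/negP => /M0.
by rewrite -mulmxA Mv mulmx0 mxE ltxx.
Qed.

(* With [z = M^-1 x], the Cauchy-Schwarz inequality of the form [M] reads
   [|x|^4 = (x^T M z)^2 <= (x^T M x) (x^T M^-1 x)]. *)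
Lemma pd_coercive p (M : 'M[R]_p) : pd_mx M ->
  exists2 c : R, 0 < c & forall x : 'cV_p, c * frob x ^+ 2 <= (x^T *m M *m x) 0 0.
Proof.
move=> pM; have Mu := pd_unitmx pM; have [sM _] := pM.
have d0 : 0 < frob (invmx M) + 1 by rewrite ltr_wpDl ?frob_ge0.
exists (frob (invmx M) + 1)^-1 => [|x]; first by rewrite invr_gt0.
rewrite mulrC ler_pdivrMr//.
have [->|x0] := eqVneq x 0; first by rewrite frob0 mulmx0 mxE expr0n mul0r.
have := psd_cauchy_schwarz x (invmx M *m x) (pd_psd pM).
rewrite mulmxA mulmxK// trmx_mul trmx_inv sM mulmxKV// sqr_frob_cV.
rewrite mulmxA => le1.
have x2 : 0 < frob x ^+ 2 by rewrite exprn_gt0 ?frob_gt0.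
rewrite -(ler_pM2r x2) -expr2; apply: le_trans le1 _.
rewrite -mulrA ler_wpM2l ?(pd_psd pM).2//.
apply: le_trans (ler_norm _) _; apply: le_trans (norm_bilinear_le _ _ _) _.
by rewrite -expr2 ler_pM2r// lerDl.
Qed.

(** The form of [S] is at least [- |S| |x|^2], a deficit that [t P] covers. *)
Lemma psd_addZ p (A P S : 'M[R]_p) (t : R) : sym_mx S ->
  (forall x : 'cV_p, frob S * frob x ^+ 2 <= t * (x^T *m P *m x) 0 0) ->
  sym_mx P -> psd_mx (S + t *: P).
Proof.
move=> sS tP sP; split; first by rewrite /sym_mx linearD linearZ /= sS sP.
move=> x; rewrite mulmxDr mulmxDl -scalemxAr -scalemxAl mxE [X in _ + X]mxE.
have := norm_bilinear_le S x x; rewrite -expr2 ler_norml => /andP[lo _].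
rewrite -lerBlDl sub0r; apply: le_trans (tP x).
by rewrite lerNl.
Qed.

(* [S] solves [A^T S + S A = -1]; [S + t P] remains a strict Lyapunov matrix,
   and is positive semidefinite for [t] large. *)
Lemma hurwitz_strict_lyapunov p (A P : 'M[R]_p) :
  hurwitz A -> pd_mx P ->
  (forall x : 'cV_p, (x^T *m lyapunov A P *m x) 0 0 <= 0) ->
  exists2 S : 'M[R]_p, psd_mx S &
    forall x : 'cV_p, (x^T *m lyapunov A S *m x) 0 0 <= - frob x ^+ 2.
Proof.
move=> hA pP neg; have [sP _] := pP.
have [solve [d _ dL]] := lyapunov_solvable hA; have [S SE] := solve (- 1%:M).
(* [S^T] solves the same equation, whose solution is unique. *)
have sS : sym_mx S.
  apply/eqP; rewrite -subr_eq0; apply/eqP; apply: (hurwitz_lyapunov_eq0 hA).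
  have LT : lyapunov A S^T = (lyapunov A S)^T.
    by rewrite /lyapunov [RHS]linearD /= !trmx_mul trmxK addrC.
  rewrite -/(lyapunov A (S^T - S)) linearB /= LT SE linearN /= trmx1.
  by rewrite subrr.
have [c c0 cP] := pd_coercive pP.
(* Since [c |x|^2 <= x^T P x], this multiple of [P] dominates [|S| |x|^2]. *)
have t0 : 0 <= frob S / c by rewrite divr_ge0 ?frob_ge0 ?ltW.
exists (S + (frob S / c) *: P).
  apply: psd_addZ => // x.
  by rewrite -mulrA ler_wpM2l ?frob_ge0// ler_pdivlMl.
move=> x; rewrite [lyapunov A _]linearD /= [lyapunov A (_ *: _)]linearZ /= SE.
rewrite mulmxDr mulmxDl mulmxN mulmx1 mulNmx mxE.
rewrite [(- _ : 'M[R]_(_, _)) 0 0]mxE sqr_frob_cV -[leRHS]addr0 lerD2l.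
by rewrite -scalemxAr -scalemxAl mxE mulr_ge0_le0.
Qed.

(** A strict Lyapunov matrix of [A] still certifies [A + E] for small [E], and the lower bound on
    the Lyapunov operator survives because the perturbing term can be absorbed. *)
Lemma hurwitz_lyapunov_stable p (A P : 'M[R]_p) :
  hurwitz A -> pd_mx P ->
  (forall x : 'cV_p, (x^T *m lyapunov A P *m x) 0 0 <= 0) ->
  exists eta c : R, [/\ 0 < eta, 0 < c & forall E : 'M[R]_p, frob E < eta ->
    hurwitz (A + E) /\ forall X, frob X <= c * frob (lyapunov (A + E) X)].
Proof.
move=> hA pP neg; have [S pS SL] := hurwitz_strict_lyapunov hA pP neg.
have [_ [d d0 dL]] := lyapunov_solvable hA.
have S0 : 0 < 2 * frob S + 1 by rewrite ltr_wpDl ?mulr_ge0 ?frob_ge0.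
(* The first radius gives [2 |E| |S| < 1], so the form of [S] keeps its sign. The second gives
   [2 d |E| <= 1/2], so half of [|X|] is absorbed and [d] doubles. *)
exists (Num.min (2 * frob S + 1)^-1 (4 * d)^-1), (2 * d); split.
- by rewrite lt_min !invr_gt0 S0 mulr_gt0.
- by rewrite mulr_gt0.
move=> E; rewrite lt_min => /andP[E1 E2]; split.
  apply: lyapunov_hurwitz pS _ => x x0; rewrite lyapunovDl mulmxDr mulmxDl mxE.
  have x2 : 0 < frob x ^+ 2 by rewrite exprn_gt0 ?frob_gt0.
  apply: le_lt_trans (lerD (SL x) (ler_norm _)) _.
  rewrite addrC subr_lt0; apply: le_lt_trans (norm_bilinear_le _ _ _) _.
  rewrite -expr2 gtr_pMl//; apply: le_lt_trans (frob_lyapunov _ _) _.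
  rewrite -mulrA mulrCA.
  apply: (@le_lt_trans _ _ (frob E * (2 * frob S + 1))).
    by rewrite ler_wpM2l ?frob_ge0// lerDl.
  by rewrite -ltr_pdivlMr// div1r.
move=> X; have LX : frob (lyapunov A X) <=
    frob (lyapunov (A + E) X) + 2 * frob E * frob X.
  rewrite -[lyapunov A X](addrK (lyapunov E X)) -lyapunovDl.
  by apply: le_trans (frobB _ _) _; rewrite lerD2l frob_lyapunov.
have := dL X; rewrite -(ler_pM2l d0) in LX => /le_trans/(_ LX).
have : 2 * d * frob E <= 2^-1.
  rewrite mulrC -ler_pdivlMr ?mulr_gt0//; apply: le_trans (ltW E2) _.
  by rewrite -invfM lef_pV2 ?posrE ?mulr_gt0//; lra.
move=> /(ler_wpM2r (frob_ge0 X)); nra.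
Qed.

Lemma observable_inj p q (A : 'M[R]_p) (C : 'M[R]_(q, p)) (x : 'cV[R]_p) :
  observable A C -> (forall i, C *m A ^+ i *m x = 0) -> x = 0.
Proof.
rewrite /observable -[X in X = _]mxrank_tr => /eqP rk Cx.
apply: trmx_inj; rewrite trmx0.
apply: (row_free_inj rk); rewrite /= mul0mx -trmx_mul.
rewrite mxcol_mul; under eq_mxcol => i do rewrite Cx.
by rewrite mxcol0 trmx0.
Qed.

(* An eigenvector [x + i y] with [Re z >= 0] satisfies [x^T W x = y^T W y = 0],
   so it spans an [A]-invariant space in the kernel of [C]. *)
Lemma observable_hurwitz p q (A M P W : 'M[R]_p) (C : 'M[R]_(q, p)) :
  observable A C -> pd_mx P -> lyapunov M P = - W ->
  (forall x : 'cV_p, 0 <= (x^T *m W *m x) 0 0) ->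
  (forall x : 'cV_p, (x^T *m W *m x) 0 0 = 0 -> C *m x = 0 /\ M *m x = A *m x) ->
  hurwitz M.
Proof.
move=> obs pP LP W0 WC z /eigenvalue_real_imaginary[x [y [xy0 Mx My]]].
rewrite ltNge; apply/negP => z0.
have E (w : 'cV_p) : (w^T *m lyapunov M P *m w) 0 0 = - (w^T *m W *m w) 0 0.
  by rewrite LP mulmxN mulNmx mxE.
have := lyapunov_eigenvector pP.1 Mx My; rewrite !E -opprD.
set s := _ + _ => sE.
have s_ge0 : 0 <= s by rewrite addr_ge0.
have s_eq0 : s = 0.
  apply/eqP; rewrite eq_le s_ge0 -oppr_ge0 sE.
  by rewrite !mulr_ge0 ?addr_ge0// (pd_psd pP).2.
have /andP[/eqP/WC[Cx MAx] /eqP/WC[Cy MAy]] :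
    ((x^T *m W *m x) 0 0 == 0) && ((y^T *m W *m y) 0 0 == 0).
  by rewrite -paddr_eq0// -/s s_eq0.
rewrite MAx in Mx; rewrite MAy in My.
have CA i : C *m A ^+ i *m x = 0 /\ C *m A ^+ i *m y = 0.
  elim: i => [|i [IHx IHy]]; first by rewrite expr0 mulmx1.
  have -> : A ^+ i.+1 = A ^+ i *m A by exact: exprSr.
  have comb a b : C *m A ^+ i *m (a *: x + b *: y) = 0.
    by rewrite mulmxDr -!scalemxAr IHx IHy !scaler0 addr0.
  by rewrite !mulmxA -!(mulmxA _ A) Mx My -scaleNr !comb.
have /(observable_inj obs) x0 : forall i, C *m A ^+ i *m x = 0 by move=> i; case: (CA i).
have /(observable_inj obs) y0 : forall i, C *m A ^+ i *m y = 0 by move=> i; case: (CA i).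
by move: xy0; rewrite x0 y0 eqxx.
Qed.

End Definite.

(** * The scalar recursion with contraction factor [sigma] *)

Section Recursion.
Variables (R : realType) (sigma c : R) (e d : nat -> R).
Hypotheses (sigma01 : 0 < sigma < 1) (c0 : 0 < c).
Hypothesis e_rec : forall i, e i.+1 <= sigma * e i + c * d i.

(** [c / (1 - sigma)] is the fixed point of [x = sigma x + c]. The starting index [k] is free so
    that the estimate can be restarted late, once the disturbances are small. *)
Lemma contraction_le (s : R) (k : nat) :
  (forall i, (k <= i)%N -> d i <= s) -> 0 <= s ->
  forall i, e (k + i)%N <= sigma ^+ i * e k + c / (1 - sigma) * s.
Proof.
case/andP: sigma01 => sigma_gt0 sigma_lt1 ds s0.
have s1 : 0 < 1 - sigma by rewrite subr_gt0.
elim=> [|i IH].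
  by rewrite addn0 expr0 mul1r lerDl mulr_ge0// divr_ge0// ltW.
rewrite addnS; apply: le_trans (e_rec _) _.
have -> : sigma ^+ i.+1 * e k + c / (1 - sigma) * s =
    sigma * (sigma ^+ i * e k + c / (1 - sigma) * s) + c * s.
  by rewrite exprS; field; apply: lt0r_neq0.
by rewrite lerD// ler_pM2l// ds// leq_addr.
Qed.

(** From an index [N] on, the disturbances contribute at most [eps / 2]; after [M] more steps the
    geometric term started at [N] is also below [eps / 2]. *)
Lemma contraction_cvg0 : (forall i, 0 <= e i) ->
  d @ \oo --> (0 : R) -> e @ \oo --> (0 : R).
Proof.
case/andP: sigma01 => sigma_gt0 sigma_lt1 e0 /cvgrPdist_le d_cvg.
have s1 : 0 < 1 - sigma by rewrite subr_gt0.
apply/cvgrPdist_le => eps eps0.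
have t0 : 0 < (1 - sigma) / c * (eps / 2) by rewrite mulr_gt0 ?divr_gt0.
have [N _ dN] := d_cvg _ t0.
have ekE := contraction_le (k := N) (s := (1 - sigma) / c * (eps / 2)).
have : sigma ^+ i * e N @[i --> \oo] --> (0 : R).
  rewrite -[X in _ --> X](mul0r (e N)); apply: cvgMl.
  by apply: cvg_expr; rewrite ger0_norm// ltW.
move=> /cvgrPdist_le /(_ (eps / 2)) [|M _ geoM]; first by rewrite divr_gt0.
exists (N + M)%N => // i /= NMi; rewrite sub0r normrN ger0_norm//.
have Ni : (N <= i)%N by apply: leq_trans NMi; rewrite leq_addr.
rewrite -(subnKC Ni); apply: le_trans (ekE _ _ _) _.
- move=> j Nj; have := dN j Nj; rewrite /= sub0r normrN.
  by apply: le_trans; rewrite ler_norm.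
- exact: ltW.
have := geoM (i - N)%N; rewrite /= leq_subRL// => /(_ NMi).
rewrite sub0r normrN => /(le_trans (ler_norm _)).
have -> : c / (1 - sigma) * ((1 - sigma) / c * (eps / 2)) = eps / 2.
  by field; rewrite !lt0r_neq0.
by move=> ?; lra.
Qed.

End Recursion.

(** * Policy evaluation and policy improvement near the optimal gain *)

Section LQR.
Variables (R : realType) (n m : nat).
Variables (A : 'M[R]_n) (B : 'M[R]_(n, m)) (Q Qh : 'M[R]_n) (Rm : 'M[R]_m).
Variable Ps : 'M[R]_n.
Hypotheses (symQh : sym_mx Qh) (QhQ : Qh *m Qh = Q) (obs : observable A Qh).
Hypotheses (pdR : pd_mx Rm) (pdPs : pd_mx Ps) (ric : riccati A B Q Rm Ps).

Let Ks : 'M[R]_(m, n) := invmx Rm *m B^T *m Ps.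

(** [Rm Ks = B^T Ps] rewrites each term in [B], and the Riccati equation rewrites [A^T Ps + Ps A].
    This is the common source of the next two identities. *)
Lemma lyapunov_closed_loop (K : 'M[R]_(m, n)) :
  lyapunov (A - B *m K) Ps =
  Ks^T *m Rm *m Ks - Q - K^T *m Rm *m Ks - Ks^T *m Rm *m K.
Proof.
have Ru := pd_unitmx pdR.
have RKs : Rm *m Ks = B^T *m Ps by rewrite /Ks -mulmxA mulKVmx.
have KsR : Ks^T *m Rm = Ps *m B.
  by have := congr1 trmx RKs; rewrite (trmx_mul Rm) (trmx_mul B^T) trmxK pdR.1 pdPs.1.
have KRK : Ps *m B *m invmx Rm *m B^T *m Ps = Ks^T *m Rm *m Ks.
  by rewrite KsR /Ks !mulmxA.
move: ric; rewrite /riccati KRK /lyapunov => /eqP; rewrite addr_eq0 => /eqP ricE.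
rewrite [(A - _)^T]linearB /= trmx_mul mulmxBl mulmxBr.
have -> : K^T *m B^T *m Ps = K^T *m Rm *m Ks by rewrite -!mulmxA RKs.
have -> : Ps *m (B *m K) = Ks^T *m Rm *m K by rewrite mulmxA KsR.
rewrite addrACA -opprD.
have -> : A^T *m Ps + Ps *m A = Ks^T *m Rm *m Ks - Q.
  by apply: (@addIr _ (- (Ks^T *m Rm *m Ks))); rewrite ricE addrAC subrr add0r.
by rewrite opprD !addrA.
Qed.

(** Subtracting [lyapunov_closed_loop] from the evaluation equation completes a square in
    [K - Ks]. *)
Lemma pe_eq_sub (K : 'M[R]_(m, n)) (P : 'M[R]_n) : pe_eq A B Q Rm K P ->
  lyapunov (A - B *m K) (P - Ps) = - ((K - Ks)^T *m Rm *m (K - Ks)).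
Proof.
rewrite /pe_eq -/(lyapunov _ P) => /eqP; rewrite -addrA addr_eq0 => /eqP PE.
rewrite linearB /= lyapunov_closed_loop PE.
rewrite [(K - Ks)^T]linearB /= mulmxBr !mulmxBl.
move: (K^T *m Rm *m K) (K^T *m Rm *m Ks) (Ks^T *m Rm *m K) (Ks^T *m Rm *m Ks).
by move=> X Y Z T; apply/matrixP => i j; rewrite !mxE; ring.
Qed.

Lemma optimal_pe : lyapunov (A - B *m Ks) Ps = - (Q + Ks^T *m Rm *m Ks).
Proof.
rewrite lyapunov_closed_loop; move: (Ks^T *m Rm *m Ks) => T.
by apply/matrixP => i j; rewrite !mxE; ring.
Qed.

Lemma stage_costE (x : 'cV[R]_n) :
  (x^T *m (Q + Ks^T *m Rm *m Ks) *m x) 0 0 =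
  frob (Qh *m x) ^+ 2 + ((Ks *m x)^T *m Rm *m (Ks *m x)) 0 0.
Proof.
rewrite -sqr_frob_cV !trmx_mul symQh -QhQ mulmxDr mulmxDl mxE.
by rewrite !mulmxA.
Qed.

(** Zero stage cost forces [Qh x = 0] and, [Rm] being definite, [Ks x = 0]; the closed loop then
    acts on [x] as [A], and observability excludes unstable modes. *)
Lemma optimal_hurwitz : hurwitz (A - B *m Ks).
Proof.
apply: (observable_hurwitz obs pdPs optimal_pe) => x; rewrite stage_costE.
  by rewrite addr_ge0 ?sqr_ge0// (pd_psd pdR).2.
move/eqP; rewrite paddr_eq0 ?sqr_ge0 ?(pd_psd pdR).2//.
rewrite sqrf_eq0 frob_eq0 => /andP[/eqP -> Kx]; split => //.
have [Kx0|/(pdR.2)] := eqVneq (Ks *m x) 0; last by rewrite (eqP Kx) ltxx.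
by rewrite mulmxBl -mulmxA Kx0 mulmx0 subr0.
Qed.

Lemma policy_evaluation_quadratic : exists eta c : R, [/\ 0 < eta, 0 < c &
  forall K : 'M[R]_(m, n), frob (K - Ks) < eta ->
    hurwitz (A - B *m K) /\
    forall P, pe_eq A B Q Rm K P -> frob (P - Ps) <= c * frob (K - Ks) ^+ 2].
Proof.
have [x|eta [c [eta0 c0 stab]]] :=
    hurwitz_lyapunov_stable optimal_hurwitz pdPs.
  rewrite optimal_pe mulmxN mulNmx mxE stage_costE oppr_le0.
  by rewrite addr_ge0 ?sqr_ge0// (pd_psd pdR).2.
have B0 : 0 < frob B + 1 by rewrite ltr_wpDl ?frob_ge0.
(* The radius makes [B (K - Ks)] smaller than the allowed perturbation of the closed loop; the
   factor [frob Rm + 1] bounds the right side of [pe_eq_sub]. *)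
exists (eta / (frob B + 1)), (c * (frob Rm + 1)); split.
- by rewrite divr_gt0.
- by rewrite mulr_gt0// ltr_wpDl ?frob_ge0.
move=> K; rewrite ltr_pdivlMr// => Keta.
have AE : A - B *m K = A - B *m Ks + - (B *m (K - Ks)).
  by rewrite mulmxBr opprB addrA subrK.
have /stab[hK cK] : frob (- (B *m (K - Ks))) < eta.
  rewrite frobN; apply: le_lt_trans (frobM _ _) _; apply: le_lt_trans Keta.
  by rewrite mulrC ler_wpM2l ?frob_ge0// lerDl.
rewrite -AE in hK cK; split=> // P pe.
have := cK (P - Ps); rewrite pe_eq_sub// frobN => /le_trans; apply.
rewrite -mulrA ler_pM2l//; apply: le_trans (frobM _ _) _.
rewrite expr2 mulrA ler_wpM2r ?frob_ge0//; apply: le_trans (frobM _ _) _.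
by rewrite frob_tr mulrC ler_wpM2r ?frob_ge0// lerDl.
Qed.

(** A kernel vector satisfies [v = - M^-1 D v], hence [|v| <= q |v|] with [q < 1]. *)
Lemma unitmx_perturbation p (M D : 'M[R]_p) : M \in unitmx ->
  frob (invmx M) * frob D < 1 -> M + D \in unitmx.
Proof.
move=> Mu MD; rewrite -unitmx_tr -row_free_unit; apply: inj_row_free => v.
move=> /(congr1 trmx); rewrite trmx_mul trmxK trmx0 mulmxDl => /eqP.
rewrite addr_eq0 => /eqP /(congr1 (mulmx (invmx M))); rewrite mulKmx// => vE.
apply: trmx_inj; rewrite trmx0; apply/eqP/negPn/negP => /frob_gt0 v0.
have : frob v^T <= frob (invmx M) * frob D * frob v^T.
  rewrite {1}vE mulmxN frobN -mulrA; apply: le_trans (frobM _ _) _.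
  by rewrite ler_wpM2l ?frob_ge0// frobM.
by rewrite -(ltr_pM2r v0) mul1r in MD; rewrite leNgt MD.
Qed.

(** The gain error solves [E = R^-1 (D21 - D22 (K0 + E))]. As [|R^-1| |D| <= 1/2], the term in [E]
    on the right is absorbed, which produces the factor 2. *)
Lemma policy_improvement_error (P : 'M[R]_n) (D : 'M[R]_(n + m)) :
  2 * frob (invmx Rm) * frob D <= 1 ->
  let G := Gtilde A B Q Rm P + D in let K0 := invmx Rm *m B^T *m P in
  drsubmx G \in unitmx /\
  frob (invmx (drsubmx G) *m dlsubmx G - K0) <=
    2 * frob (invmx Rm) * frob D * (1 + frob K0).
Proof.
move=> rD G K0; have Ru := pd_unitmx pdR.
have G22 : drsubmx G = Rm + drsubmx D.
  by rewrite /G /Gtilde -{1}[D]submxK add_block_mx block_mxKdr.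
have G21 : dlsubmx G = B^T *m P + dlsubmx D.
  by rewrite /G /Gtilde -{1}[D]submxK add_block_mx block_mxKdl.
have r0 := frob_ge0 (invmx Rm); have D0 := frob_ge0 D.
have D22 : frob (invmx Rm) * frob (drsubmx D) <= frob (invmx Rm) * frob D.
  by rewrite ler_wpM2l// frob_drsubmx.
have Gu : drsubmx G \in unitmx.
  by rewrite G22 unitmx_perturbation//; apply: le_lt_trans D22 _; lra.
split=> //; set K := _ *m _; set E := K - K0.
have GK : Rm *m K + drsubmx D *m K = Rm *m K0 + dlsubmx D.
  by rewrite -mulmxDl -G22 mulKVmx// G21 /K0 -!mulmxA mulKVmx.
have EE : E = invmx Rm *m (dlsubmx D - drsubmx D *m (K0 + E)).
  have -> : K0 + E = K by rewrite /E addrCA subrr addr0.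
  have -> : dlsubmx D - drsubmx D *m K = Rm *m E.
    rewrite /E mulmxBr; apply/eqP; rewrite subr_eq addrAC eq_sym subr_eq.
    by rewrite GK addrC.
  by rewrite mulKmx.
have E0 := frob_ge0 E.
have : frob E <= frob (invmx Rm) * (frob D + frob D * (frob K0 + frob E)).
  rewrite {1}EE; apply: le_trans (frobM _ _) _; rewrite ler_wpM2l//.
  apply: le_trans (frobB _ _) _; rewrite lerD ?frob_dlsubmx//.
  apply: le_trans (frobM _ _) _.
  by rewrite ler_pM ?frob_ge0 ?frob_drsubmx ?frobD.
nra.
Qed.

End LQR.

(** * Local input-to-state stability of the iteration *)

Lemma ereal_sup_nneg_fin (R : realType) (d : nat -> R) (u : R) :
  (forall i, 0 <= d i) ->
  (ereal_sup (range (fun i => (d i)%:E)) < u%:E)%E ->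
  exists s : R, [/\ ereal_sup (range (fun i => (d i)%:E)) = s%:E, 0 <= s, s < u &
    forall i, d i <= s].
Proof.
move=> d0 supu; have ub i : ((d i)%:E <= ereal_sup (range (fun i => (d i)%:E)))%E.
  by apply: ereal_sup_ubound; exists i.
(* The strict bound excludes [+oo], and the member [d 0] excludes [-oo]. *)
case: (ereal_sup _) supu ub => [s||] //; last by move=> _ /(_ 0%N).
rewrite lte_fin => su ub; have ds i : d i <= s by have := ub i; rewrite lee_fin.
by exists s; split=> //; apply: le_trans (ds 0%N).
Qed.

Theorem theorem2 (R : realType) (n m : nat)
  (A : 'M[R]_n) (B : 'M[R]_(n, m)) (Q Qh : 'M[R]_n) (Rm : 'M[R]_m)
  (Ps : 'M[R]_n) :
  controllable A B ->
  psd_mx Q -> psd_mx Qh -> Qh *m Qh = Q -> observable A Qh ->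
  pd_mx Rm ->
  pd_mx Ps -> riccati A B Q Rm Ps ->
  forall sigma : R, 0 < sigma < 1 ->
  exists delta0 : R, 0 < delta0 /\
    (forall P : 'M[R]_n, sym_mx P -> frob (P - Ps) < delta0 ->
       hurwitz (calA A B Rm P) /\
       forall Pp : 'M[R]_n, sym_mx Pp ->
         (calA A B Rm P)^T *m Pp + Pp *m calA A B Rm P
           = - Q - P *m B *m invmx Rm *m B^T *m P ->
         frob (Pp - Ps) <= sigma * frob (P - Ps)) /\
    exists delta1 c3 : R, 0 < delta1 /\ 0 < c3 /\
      forall (P0 : 'M[R]_n) (DG : nat -> 'M[R]_(n + m))
             (Kh : nat -> 'M[R]_(m, n)) (Pt : nat -> 'M[R]_n),
        sym_mx P0 ->
        DG 0%N = 0 -> (forall i, sym_mx (DG i)) ->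
        robust_PI A B Q Rm P0 DG Kh Pt ->
        frob (P0 - Ps) < delta0 ->
        (ereal_sup (range (fun i => (frob (DG i))%:E)) < delta1%:E)%E ->
        [/\ (forall i : nat, (0 < i)%N ->
               drsubmx (Ghat A B Q Rm DG Pt i) \in unitmx /\
               hurwitz (A - B *m Kh i)),
            (forall i : nat,
               ((frob (Pt i - Ps))%:E
                <= (sigma ^+ i * frob (P0 - Ps))%:E
                   + (c3 / (1 - sigma))%:E
                     * ereal_sup (range (fun j => (frob (DG j))%:E)))%E) &
            ((fun i => frob (DG i)) @ \oo --> (0 : R) ->
             (fun i => frob (Pt i - Ps)) @ \oo --> (0 : R))].
Proof.
move=> _ _ [symQh _] QhQ obs pdR pdPs ric sigma sigma01.
have /andP[sigma_gt0 sigma_lt1] := sigma01.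
have s1 : 0 < 1 - sigma by rewrite subr_gt0.
have [eta [c [eta0 c0 quad]]] :=
  policy_evaluation_quadratic symQh QhQ obs pdR pdPs ric.
set Ks := invmx Rm *m B^T *m Ps in quad.
pose a := frob (invmx Rm *m B^T) + 1.
pose r := frob (invmx Rm) + 1.
have a0 : 0 < a by rewrite ltr_wpDl ?frob_ge0.
have r0 : 0 < r by rewrite ltr_wpDl ?frob_ge0.
(* The first term spends half of [eta] on the error of [P], leaving the other half to the
   disturbance; the second turns the quadratic term into a contraction by [sigma]. *)
pose delta0 := Num.min (eta / (2 * a)) (sigma / (2 * c * a ^+ 2)).
have delta0_gt0 : 0 < delta0.
  by rewrite lt_min !divr_gt0// ?mulr_gt0// exprn_gt0.
have delta0_eta : a * delta0 <= eta / 2.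
  have -> : eta / 2 = a * (eta / (2 * a)) by field; rewrite lt0r_neq0.
  by rewrite ler_pM2l// ge_min lexx.
have delta0_sigma : 2 * c * a ^+ 2 * delta0 <= sigma.
  have ca0 : 0 < 2 * c * a ^+ 2 by rewrite !mulr_gt0// ?exprn_gt0.
  by rewrite mulrC -ler_pdivlMr// ge_min lexx orbT.
(* Gain error per unit of disturbance, from [policy_improvement_error] with [|K0| <= a |P|] and
   [|P| <= delta0 + |Ps|]. *)
pose b := 2 * r * (1 + a * (delta0 + frob Ps)).
have b0 : 0 < b.
  rewrite !mulr_gt0// ltr_wpDr// mulr_ge0 ?ltW//.
  by rewrite ltr_wpDr ?frob_ge0.
pose c3 := 2 * c * b ^+ 2.
have c3_gt0 : 0 < c3.
  by apply: mulr_gt0; [apply: mulr_gt0|apply: exprn_gt0].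
have gain_dist (P : 'M[R]_n) :
    frob (invmx Rm *m B^T *m P - Ks) <= a * frob (P - Ps).
  rewrite -mulmxBr; apply: le_trans (frobM _ _) _.
  by rewrite ler_wpM2r ?frob_ge0// lerDl.
(* One iteration, with [e] the error of the current [P] and [d] the size of the disturbance: [d = 0]
   yields the exact contraction. The bound [d <= 1] replaces [d^2] by [d]. *)
have step (K : 'M[R]_(m, n)) (e d : R) : 0 <= e < delta0 -> 0 <= d <= 1 ->
    b * d < eta / 2 -> frob (K - Ks) <= a * e + b * d ->
    hurwitz (A - B *m K) /\ forall P, pe_eq A B Q Rm K P ->
      frob (P - Ps) <= sigma * e + c3 * d.
  move=> /andP[e0 e1] /andP[d0 d1] bd Kd.
  have ae : a * e <= a * delta0 by rewrite ler_pM2l// ltW.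
  have /quad[hK PK] : frob (K - Ks) < eta by lra.
  split=> // P /PK/le_trans; apply.
  have K2 : frob (K - Ks) ^+ 2 <= (a * e + b * d) ^+ 2.
    by rewrite ler_pXn2r ?nnegrE ?frob_ge0// (le_trans _ Kd)// frob_ge0.
  have : (a * e + b * d) ^+ 2 <= 2 * (a * e) ^+ 2 + 2 * (b * d) ^+ 2.
    by have := sqr_ge0 (a * e - b * d); rewrite sqrrB sqrrD; lra.
  move=> /(le_trans K2); rewrite -(ler_pM2l c0) => /le_trans; apply.
  rewrite mulrDr lerD//.
    have -> : c * (2 * (a * e) ^+ 2) = 2 * c * a ^+ 2 * e * e by ring.
    rewrite ler_wpM2r//; apply: le_trans delta0_sigma.
    by rewrite ler_wpM2l ?ltW// !mulr_gt0// ?exprn_gt0.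
  have -> : c * (2 * (b * d) ^+ 2) = c3 * (d * d) by rewrite /c3; ring.
  by rewrite ler_pM2l// ler_piMr.
exists delta0; split=> //; split.
  move=> P sP Pd.
  have calAE : calA A B Rm P = A - B *m (invmx Rm *m B^T *m P).
    by rewrite /calA !mulmxA.
  have [||||hK PK] := step (invmx Rm *m B^T *m P) (frob (P - Ps)) 0.
  - by rewrite frob_ge0.
  - by rewrite lexx ler01.
  - by rewrite mulr0 divr_gt0.
  - by rewrite mulr0 addr0.
  rewrite calAE; split=> // Pp _ PpE.
  (* For [K = R^-1 B^T P] one has [K^T R K = P B R^-1 B^T P], so [Pp] evaluates [K]. *)
  have /PK : pe_eq A B Q Rm (invmx Rm *m B^T *m P) Pp.
    rewrite /pe_eq PpE !trmx_mul trmxK trmx_inv pdR.1 sP.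
    by rewrite !mulmxA mulmxKV ?pd_unitmx// -addrA (addrC Q) addrA subrK addNr.
  by rewrite mulr0 addr0.
(* In order: [d^2 <= d]; invertibility of the perturbed block; the remaining half of [eta]; and
   [sigma delta0 + c3 d <= delta0], which keeps the iterates in the ball. *)
pose delta1 := Num.min (Num.min 1 (2 * r)^-1)
  (Num.min (eta / (2 * b)) ((1 - sigma) * delta0 / c3)).
have delta1_gt0 : 0 < delta1.
  rewrite !lt_min ltr01 invr_gt0 mulr_gt0//=.
  by apply/andP; split; apply: divr_gt0 => //; apply: mulr_gt0.
exists delta1, c3; split=> //; split=> // P0 DG Kh Pt sP0 DG0 sDG [Pt0 Kh1 PtE KhE].
move=> P0d /ereal_sup_nneg_fin[i|s [supE s0 sd DGs]]; first exact: frob_ge0.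
have DGd i : frob (DG i) < delta1 by apply: le_lt_trans sd.
(* Stated for any [K] given by the improvement formula, so that it also covers [Kh 1], which the
   iteration defines separately. *)
have rec i : frob (Pt i - Ps) < delta0 ->
    drsubmx (Ghat A B Q Rm DG Pt i) \in unitmx /\
    forall K, K = invmx (drsubmx (Ghat A B Q Rm DG Pt i)) *m
                  dlsubmx (Ghat A B Q Rm DG Pt i) ->
    hurwitz (A - B *m K) /\ forall P, pe_eq A B Q Rm K P ->
      frob (P - Ps) <= sigma * frob (Pt i - Ps) + c3 * frob (DG i).
  move=> Ptd; have := DGd i; rewrite !lt_min => /andP[/andP[d1 dr] /andP[db ds]].
  have DG_ge0 := frob_ge0 (DG i); have Pt_ge0 := frob_ge0 (Pt i - Ps).
  have rd : 2 * r * frob (DG i) <= 1.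
    by rewrite mulrC -ler_pdivlMr ?mulr_gt0// div1r ltW.
  have rr : 2 * frob (invmx Rm) * frob (DG i) <= 2 * r * frob (DG i).
    by rewrite ler_wpM2r// ler_wpM2l// lerDl.
  have [Gu Kerr] := policy_improvement_error A B Q pdR (Pt i) (le_trans rr rd).
  split=> // K KE; apply: step; rewrite ?Pt_ge0 ?DG_ge0 ?(ltW d1)//.
    have -> : eta / 2 = b * (eta / (2 * b)) by field; rewrite lt0r_neq0.
    by rewrite ltr_pM2l.
  rewrite -(subrK (invmx Rm *m B^T *m Pt i) K) -addrA addrC.
  apply: le_trans (frobD _ _) _; rewrite lerD// KE.
  apply: le_trans Kerr _; rewrite /b mulrAC.
  rewrite ler_wpM2r//; apply: ler_pM; rewrite ?mulr_ge0 ?addr_ge0 ?frob_ge0//.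
    by rewrite ler_wpM2l// lerDl.
  have PtPs : frob (Pt i) <= delta0 + frob Ps.
    rewrite -[Pt i](subrK Ps); apply: le_trans (frobD _ _) _.
    by rewrite lerD2r ltW.
  rewrite lerD2l; apply: le_trans (frobM _ _) _.
  by rewrite ler_pM ?frob_ge0// lerDl.
(* [Kh i.+1] is the improvement of [Pt i] and is evaluated by [Pt i.+1]; closeness and
   well-definedness must be carried together. *)
have inv i : [/\ frob (Pt i - Ps) < delta0,
    hurwitz (A - B *m Kh i.+1),
    drsubmx (Ghat A B Q Rm DG Pt i) \in unitmx &
    frob (Pt i.+1 - Ps) <= sigma * frob (Pt i - Ps) + c3 * frob (DG i)].
  elim: i => [|i [Ptd hK Gu Pt1]].
    rewrite Pt0; have := rec 0%N; rewrite Pt0 => /(_ P0d)[Gu Kprop].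
    have [|hK PK] := Kprop (Kh 1%N).
      (* Because [DG 0 = 0], the improvement formula at index 0 gives exactly [R^-1 B^T P0]. *)
      rewrite Kh1 /Ghat DG0 addr0 /Gtilde block_mxKdr block_mxKdl Pt0.
      by rewrite mulmxA.
    by split=> //; apply: PK; have [] := PtE 1%N isT hK.
  have Ptd1 : frob (Pt i.+1 - Ps) < delta0.
    apply: le_lt_trans Pt1 _.
    have : c3 * frob (DG i) < (1 - sigma) * delta0.
      by rewrite mulrC -ltr_pdivlMr//; have := DGd i; rewrite !lt_min => /and3P[].
    by rewrite -(ltr_pM2l sigma_gt0) in Ptd; lra.
  have [Gu1 Kprop] := rec _ Ptd1.
  have [hK1 PK1] := Kprop _ (KhE i.+1 isT hK Gu1).
  by split=> //; apply: PK1; have [] := PtE i.+2 isT hK1.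
have e_rec i : frob (Pt i.+1 - Ps) <= sigma * frob (Pt i - Ps) + c3 * frob (DG i).
  by case: (inv i).
split.
(* Stability of gain [i.+1] is recorded at index [i], invertibility at [i.+1]. *)
- by case=> // i _; have [_ ? _ _] := inv i; have [_ _ ? _] := inv i.+1.
- move=> i; rewrite supE -EFinM -EFinD lee_fin -Pt0.
  have := contraction_le sigma01 c3_gt0 e_rec (s := s) (k := 0).
  by rewrite /= => /(_ _ s0 i); apply.
- apply: (contraction_cvg0 sigma01 c3_gt0 e_rec) => i; exact: frob_ge0.
Qed.
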